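(* Let $n\ge r$ be positive integers, let $\epsilon>0$, and let $W\in\mathbb{R}^{n\times n}$ and $\Sigma\in\mathbb{R}^{r\times r}$ be diagonal matrices with $$W_{11}\geq W_{22}\geq\cdots\geq W_{nn}>0,\qquad \Sigma_{11}\geq\Sigma_{22}\geq\cdots\geq\Sigma_{rr}>0.$$ Let $\tilde P\in\mathbb{R}^{n\times r}$ be a column orthogonal matrix, i.e. $\tilde P^T\tilde P=I_r$. If $q$ is a real number such that $(2-q)/q$ is a nonnegative integer, then $$\|W^{-1}\tilde P\Sigma\|_{S_q}^{q}\;\geq\;\sum_{i=1}^{r}\left(\frac{\Sigma_{ii}}{W_{ii}}\right)^{q}$$ and $$\|W^{-1}\tilde P\Sigma\|_{L}^{1/k}\;\geq\;\sum_{i=1}^{r}\log\left(\left(\frac{\Sigma_{ii}}{W_{ii}}\right)^{1/k}+\epsilon\right)\qquad\text{for } k=1,2.$$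
   Context: For a real $m\times n$ matrix $X$ let $\sigma_1(X),\dots,\sigma_{\min\{m,n\}}(X)$ be its singular values (including zeros). For $q>0$, $\|X\|_{S_q}=\left(\sum_{i=1}^{\min\{m,n\}}\sigma_i(X)^q\right)^{1/q}$ is the Schatten-$q$ (quasi-)norm, so $\|X\|_{S_q}^q=\sum_i\sigma_i(X)^q$. For $p>0$ and the fixed constant $\epsilon>0$, the ''Logarithmic norm'' is $\|X\|_L^p=\sum_{i=1}^{\min\{m,n\}}\log(\sigma_i(X)^p+\epsilon)$ (the superscript $p$ is part of the notation, with $p=1/k$ in the claim). *)

(* Defs.v *)
From HB Require Import structures.
From mathcomp Require Import all_boot all_order all_algebra.
From mathcomp Require Import polyrcf.
From mathcomp Require Import all_classical all_reals all_analysis.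
Set Implicit Arguments.
Unset Strict Implicit.
Unset Printing Implicit Defensive.
Import Order.TTheory GRing.Theory Num.Theory.
Local Open Scope ring_scope.

(* The real eigenvalues of A in nonincreasing order, each repeated according to
   its algebraic multiplicity.  For a real symmetric A the characteristic
   polynomial splits over R, so the sequence then has length n. *)
Definition eigenvalues (R : realType) (n : nat) (A : 'M[R]_n) : seq R :=
  sort >=%R
    (flatten [seq nseq (mup x (char_poly A)) x | x <- rootsR (char_poly A)]).

(* The i-th largest singular value (i counted from 0): the square root of the
   i-th largest eigenvalue of the n x n matrix X^T X.  When m < n, the n - m
   eigenvalues left out by the index type are all zero. *)
Definition singular_value (R : realType) (m n : nat) (X : 'M[R]_(m, n))
    (i : 'I_(minn m n)) : R :=
  Num.sqrt (eigenvalues (X^T *m X))`_i.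

Definition schatten_norm (R : realType) (m n : nat) (q : R)
    (X : 'M[R]_(m, n)) : R :=
  (\sum_(i < minn m n) singular_value X i `^ q) `^ q^-1.

(* The quantity written ||X||_L^p; the exponent p is part of the notation. *)
Definition log_norm (R : realType) (m n : nat) (eps p : R)
    (X : 'M[R]_(m, n)) : R :=
  \sum_(i < minn m n) ln (singular_value X i `^ p + eps).

(* Main.v *)
(* Put X = W^-1 P Sigma, let lam_i be the squared singular values of X and
   del_i = (Sigma_ii / W_ii)^2. For every c >= 0,
     prod_i max(c, del_i) <= prod_i max(c, lam_i),
   by the argument of Li and Mathias for Lidskii's inequality: raising the
   eigenvalues of X^T X to at least c gives a matrix M with M >= X^T X and
   M >= c, and the minimax principle bounds each eigenvalue of
   Sigma^-1 M Sigma^-1 from below by max(c / Sigma_ii^2, 1 / W_ii^2); now take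
   determinants. These inequalities say that ln del is weakly majorized by
   ln lam, so sum_i phi(del_i) <= sum_i phi(lam_i) whenever phi o exp is convex
   and nondecreasing, such as phi(a) = a^(q/2) and phi(a) = ln(a^(p/2) + eps). *)

Require Import Defs.
From HB Require Import structures.
From mathcomp Require Import all_boot all_order all_algebra.
From mathcomp Require Import perm polyrcf complex.
From mathcomp Require Import all_classical all_reals all_analysis.
From mathcomp Require Import ring.
Set Implicit Arguments.
Unset Strict Implicit.
Unset Printing Implicit Defensive.
Import Order.TTheory GRing.Theory Num.Theory.
Local Open Scope ring_scope.
Local Open Scope complex_scope.
Local Open Scope sesquilinear_scope.

(** * Sorting a finite family *)

Lemma exists_sorting_perm (T : Type) (n : nat) (leT : rel T) (d : 'I_n -> T) :
  total leT -> transitive leT ->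
  exists s : 'S_n, forall i j : 'I_n, (i <= j)%N -> leT (d (s i)) (d (s j)).
Proof.
move=> leT_total leT_tr; pose leI : rel 'I_n := fun i j => leT (d i) (d j).
have leI_total : total leI by move=> i j; exact: leT_total.
have leI_tr : transitive leI by move=> i j k; exact: leT_tr.
have sz : size (sort leI (enum 'I_n)) == n by rewrite size_sort size_enum_ord.
have /tuple_permP[s sE] : perm_eq (Tuple sz) (ord_tuple n).
  by rewrite /= perm_sort perm_refl.
exists s => i j le_ij.
have nthE (k : 'I_n) : nth i (sort leI (enum 'I_n)) k = s k.
  have /= -> := sE; rewrite (nth_map i) ?size_enum_ord // nth_ord_enum.
  by rewrite tnth_ord_tuple.
have leI_refl : reflexive leI by move=> k; have := leI_total k k; rewrite orbb.
have := sorted_leq_nth leI_tr leI_refl i (sort_sorted leI_total (enum 'I_n)).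
move=> /(_ i j); rewrite !inE (eqP sz) !nthE; exact.
Qed.

(** * Hermitian forms over [R[i]] and the minimax principle *)

Section HermitianForms.
Variable R : rcfType.
Implicit Types n m r : nat.
Local Notation C := (R[i]).
Local Notation toC := (real_complex R).
Local Notation "A ^C" := (map_mx toC A).

Lemma conjC_toC (x : R) : Num.conj (toC x) = toC x.
Proof. by apply: conj_Creal; rewrite complex_real. Qed.

Lemma adj_toC m n (A : 'M[R]_(m, n)) : (A^C)^t* = (A^T)^C.
Proof. by apply/matrixP => i j; rewrite !mxE conjC_toC. Qed.

Lemma adj_mul m n p (A : 'M[C]_(m, n)) (B : 'M[C]_(n, p)) :
  (A *m B)^t* = B^t* *m A^t*.
Proof. by rewrite trmx_mul map_mxM. Qed.

Definition sqn n (z : 'rV[C]_n) : C := \sum_j `|z 0 j| ^+ 2.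

(** Vectors are rows acting from the left, so the eigenvectors of [U^t* *m D *m U] are the rows of
    [U]. *)
Definition hform n (A : 'M[C]_n) (z : 'rV[C]_n) : C := (z *m A *m z^t* ) 0 0.

Lemma hform_conj m n (A : 'M[C]_m) (B : 'M[C]_(n, m)) (z : 'rV[C]_n) :
  hform (B *m A *m B^t* ) z = hform A (z *m B).
Proof. by rewrite /hform adj_mul !mulmxA. Qed.

Lemma hform_diag n (d : 'rV[R]_n) (z : 'rV[C]_n) :
  hform (diag_mx d)^C z = \sum_j toC (d 0 j) * `|z 0 j| ^+ 2.
Proof.
rewrite /hform map_diag_mx mul_mx_diag mxE; apply: eq_bigr => j _.
by rewrite !mxE normCK mulrAC mulrC.
Qed.

Lemma hform1 n (z : 'rV[C]_n) : hform 1%:M z = sqn z.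
Proof.
rewrite /hform mulmx1 mxE; apply: eq_bigr => j _.
by rewrite !mxE normCK.
Qed.

Lemma sqn_unitary n (U : 'M[C]_n) (z : 'rV[C]_n) :
  U \is unitarymx -> sqn (z *m U) = sqn z.
Proof. by move=> /unitarymxP UU; rewrite -!hform1 -hform_conj mulmx1 UU. Qed.

Lemma sqn_gt0 n (z : 'rV[C]_n) : z != 0 -> 0 < sqn z.
Proof.
move=> z0; rewrite lt_def sumr_ge0 ?andbT; last by move=> *; rewrite exprn_ge0.
apply: contra_neq z0 => /eqP; rewrite psumr_eq0 => [/allP z0|j _]; last first.
  by rewrite exprn_ge0.
apply/rowP => j; have := z0 j (mem_index_enum _).
by rewrite expf_eq0 /= normr_eq0 mxE => /eqP.
Qed.

Lemma hform_diag_ge n (d e : 'rV[R]_n) (z : 'rV[C]_n) :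
  (forall j, z 0 j != 0 -> d 0 j <= e 0 j) ->
  hform (diag_mx d)^C z <= hform (diag_mx e)^C z.
Proof.
move=> de; rewrite !hform_diag; apply: ler_sum => j _.
have [->|zj] := eqVneq (z 0 j) 0; first by rewrite normr0 expr0n !mulr0.
by rewrite ler_pM2r ?lecR ?de // exprn_gt0 // normr_gt0.
Qed.

Lemma hform_const n (a : R) (z : 'rV[C]_n) :
  hform (diag_mx (const_mx a))^C z = toC a * sqn z.
Proof. by rewrite hform_diag mulr_sumr; apply: eq_bigr => j _; rewrite mxE. Qed.

(** Supplies constraint matrices for the minimax principle: [pid_mx i] cuts out a subspace of
    codimension [i] by killing the first [i] coordinates. *)
Lemma mul_pid_eq0 (F : pzRingType) n (k : nat) (z : 'rV[F]_n) :
  z *m (pid_mx k : 'M[F]_(n, k)) = 0 -> forall j : 'I_n, (j < k)%N -> z 0 j = 0.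
Proof.
move=> zk j lt_jk; have /rowP/(_ (Ordinal lt_jk)) := zk.
rewrite !mxE (bigD1 j) //= big1.
  by rewrite mxE /= eqxx lt_jk mulr1 addr0.
by move=> l lj; rewrite mxE /= (negPf (lj : l != j :> nat)) mulr0.
Qed.

(** The spectral theorem gives the eigenvalues in no particular order; permuting the rows of [U]
    sorts them. The order is a parameter because minimax uses the nondecreasing one and singular
    values the nonincreasing one. *)
Lemma hermitian_spectral n (leT : rel R) (A : 'M[C]_n) :
  total leT -> transitive leT -> A^t* = A ->
  exists (U : 'M[C]_n) (d : 'rV[R]_n), [/\ U \is unitarymx,
    A = U^t* *m (diag_mx d)^C *m U &
    forall i j : 'I_n, (i <= j)%N -> leT (d 0 i) (d 0 j)].
Proof.
move=> leT_total leT_tr A_adj.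
have A_herm : A \is hermsymmx.
  by apply/is_hermitianmxP; rewrite expr0 scale1r A_adj.
have := orthomx_spectralP (hermitian_normalmx A_herm).
have := hermitian_spectral_diag_real A_herm.
have := spectral_unitarymx A.
move: (spectralmx A) (spectral_diag A) => U D U_unit /mxOverP D_real.
rewrite invmx_unitary // => AE.
have [s ds] :=
  exists_sorting_perm (fun i => complex.Re (D 0 i)) leT_total leT_tr.
exists (row_perm s U), (\row_i complex.Re (D 0 (s i))).
split => [||i j]; last 1 first.
- by rewrite !mxE; exact: ds.
- rewrite row_permE mul_unitarymx //; apply/unitarymxP.
  by rewrite tr_perm_mx map_perm_mx -perm_mxM mulgV perm_mx1.
rewrite AE; apply/matrixP => i j.
rewrite map_diag_mx !mul_mx_diag !mxE (reindex_perm s) /=.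
apply: eq_bigr => k _; by rewrite !mxE RRe_real.
Qed.
Lemma mul_adj_unitary n (U : 'M[C]_n) : U \is unitarymx -> U^t* *m U = 1%:M.
Proof. by move=> U_unit; rewrite -invmx_unitary // mulVmx // unitarymx_unit. Qed.

Lemma det_unitary_conj n (U A : 'M[C]_n) :
  U \is unitarymx -> \det (U^t* *m A *m U) = \det A.
Proof.
move=> U_unit; rewrite !det_mulmx mulrAC -det_mulmx mul_adj_unitary //.
by rewrite det1 mul1r.
Qed.

Lemma hform_adj_conj m n (A : 'M[C]_m) (B : 'M[C]_(m, n)) (z : 'rV[C]_n) :
  hform (B^t* *m A *m B) z = hform A (z *m B^t* ).
Proof. by rewrite -hform_conj trmxCK. Qed.

(* The first i+1 eigenvectors span a space of dimension i+1, which meets the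
   kernel of N, of codimension at most i. *)
Lemma le_eigenvalue n (A U : 'M[C]_n) (d : 'rV[R]_n) (i : 'I_n) (t : R)
    (N : 'M[C]_(n, i)) :
  U \is unitarymx -> A = U^t* *m (diag_mx d)^C *m U ->
  (forall j k : 'I_n, (j <= k)%N -> d 0 j <= d 0 k) ->
  (forall z, z *m N = 0 -> toC t * sqn z <= hform A z) -> t <= d 0 i.
Proof.
move=> U_unit AE d_mono AN.
pose E : 'M[C]_(i.+1, n) := pid_mx i.+1.
have [v v_neq0 vK] : exists2 v : 'rV_i.+1, v != 0 & v *m (E *m U *m N) = 0.
  exists (nz_row (kermx (E *m U *m N))).
    rewrite nz_row_eq0 -mxrank_eq0 mxrank_ker -lt0n subn_gt0 ltnS.
    exact: rank_leq_col.
  by apply/sub_kermxP; exact: nz_row_sub.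
pose y := v *m E.
have y_neq0 : y != 0.
  apply: contra_neq v_neq0 => y0.
  have -> : v = y *m (pid_mx i.+1 : 'M[C]_(n, i.+1)).
    by rewrite -mulmxA pid_mx_id // pid_mx_1 mulmx1.
  by rewrite y0 mul0mx.
have y_supp j : y 0 j != 0 -> (j <= i)%N.
  apply: contraR; rewrite -ltnNge => lt_ij; rewrite mxE big1 // => k _.
  by rewrite mxE ltn_eqF ?mulr0 //; exact: leq_trans (ltn_ord k) _.
have yUN : y *m U *m N = 0 by rewrite -vK !mulmxA.
(* At [y *m U] the form is at least [t] times the squared norm, and at most [d 0 i] times it because
   [y] lives on the first [i + 1] eigenvectors. *)
have := AN _ yUN.
rewrite sqn_unitary // AE hform_adj_conj -mulmxA.
rewrite (unitarymxP U_unit) mulmx1 => /le_trans.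
move=> /(_ (toC (d 0 i) * sqn y)); rewrite -hform_const hform_diag_ge; last first.
  by move=> j /y_supp le_ji; rewrite mxE; exact: d_mono.
by rewrite hform_const ler_pM2r ?sqn_gt0 // lecR; exact.
Qed.

(** The determinant is the product of the eigenvalues, and [le_eigenvalue] bounds the i-th smallest
    of them below by [t i]. *)
Lemma prod_le_det n (A : 'M[C]_n) (t : 'I_n -> R) :
  A^t* = A -> (forall i, 0 <= t i) ->
  (forall i : 'I_n, exists N : 'M[C]_(n, i),
    forall z, z *m N = 0 -> toC (t i) * sqn z <= hform A z) ->
  toC (\prod_i t i) <= \det A.
Proof.
move=> A_adj t_ge0 At.
have [U [d [U_unit AE d_mono]]] := hermitian_spectral le_total le_trans A_adj.
rewrite AE det_unitary_conj // det_map_mx det_diag lecR.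
apply: ler_prod => i _; rewrite t_ge0 /=.
have [N AN] := At i; exact: le_eigenvalue U_unit AE d_mono AN.
Qed.

Lemma sqn_mul_diag n (d : 'rV[R]_n) (z : 'rV[C]_n) :
  sqn (z *m (diag_mx d)^C) = hform (diag_mx (\row_j d 0 j ^+ 2))^C z.
Proof.
rewrite hform_diag; apply: eq_bigr => j _.
rewrite map_diag_mx mul_mx_diag !mxE normrM exprMn mulrC rmorphXn /=.
by rewrite real_normK // complex_real.
Qed.

Lemma hform_gram m n (X : 'M[R]_(m, n)) (z : 'rV[C]_n) :
  hform (X^T *m X)^C z = sqn (z *m (X^T)^C).
Proof. by rewrite -hform1 -hform_conj mulmx1 adj_toC trmxK map_mxM. Qed.

Lemma le_sqr_inv_diag n (d : 'rV[R]_n) (i : 'I_n) (z : 'rV[C]_n) :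
  (forall j, 0 < d 0 j) ->
  (forall j k : 'I_n, (j <= k)%N -> d 0 k <= d 0 j) ->
  z *m (pid_mx i : 'M[C]_(n, i)) = 0 ->
  toC ((d 0 i)^-1 ^+ 2) * sqn z <= sqn (z *m (diag_mx (\row_j (d 0 j)^-1))^C).
Proof.
move=> d_gt0 d_mono /mul_pid_eq0 z0; rewrite sqn_mul_diag -hform_const.
apply: hform_diag_ge => j; rewrite !mxE; case: (ltnP j i) => [/z0 ->|le_ij _].
  by rewrite eqxx.
rewrite ler_pXn2r ?nnegrE ?invr_ge0 ?(ltW (d_gt0 _)) //.
by rewrite lef_pV2 ?posrE ?d_mono.
Qed.

(* Compare A = S^-1 U^* max(c, lam) U S^-1 with the two forms c S^-2 and
   P^T W^-2 P that it dominates, the first because of c and the second because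
   it is S^-1 X^T X S^-1; the i-th smallest eigenvalue of A is therefore at
   least max(c / S_i^2, 1 / W_i^2). *)
Lemma prod_max_le_eigenvalues n r (le_rn : (r <= n)%N) (w : 'rV[R]_n)
    (s : 'rV[R]_r) (P X : 'M[R]_(n, r)) (U : 'M[C]_r) (lam : 'rV[R]_r) (c : R) :
  (forall i, 0 < w 0 i) -> (forall i j : 'I_n, (i <= j)%N -> w 0 j <= w 0 i) ->
  (forall i, 0 < s 0 i) -> (forall i j : 'I_r, (i <= j)%N -> s 0 j <= s 0 i) ->
  P^T *m P = 1%:M -> X = diag_mx (\row_i (w 0 i)^-1) *m P *m diag_mx s ->
  U \is unitarymx -> (X^T *m X)^C = U^t* *m (diag_mx lam)^C *m U -> 0 <= c ->
  \prod_i Num.max c ((s 0 i / w 0 (widen_ord le_rn i)) ^+ 2) <=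
  \prod_i Num.max c (lam 0 i).
Proof.
move=> w_gt0 w_mono s_gt0 s_mono P_orth XE U_unit gramE c_ge0.
pose V := \row_i (w 0 i)^-1; pose T := (diag_mx (\row_i (s 0 i)^-1))^C.
pose L := \row_i Num.max c (lam 0 i).
pose A := T *m (U^t* *m (diag_mx L)^C *m U) *m T^t*.
have T_adj : T^t* = T by rewrite adj_toC tr_diag_mx.
pose t i := Num.max (c * (s 0 i)^-1 ^+ 2) ((w 0 (widen_ord le_rn i))^-1 ^+ 2).
have hformA z : hform A z = hform (diag_mx L)^C (z *m T *m U^t* ).
  by rewrite hform_conj hform_adj_conj.
have A_adj : A^t* = A.
  by rewrite /A T_adj !adj_mul T_adj trmxCK adj_toC tr_diag_mx !mulmxA.
have t_ge0 i : 0 <= t i by rewrite le_max exprn_ge0 ?orbT // invr_ge0 ltW.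
have TX : T *m (X^T)^C = (P^T)^C *m (diag_mx V)^C.
  rewrite -!map_mxM; congr (_^C); rewrite XE !trmx_mul !tr_diag_mx !mulmxA.
  rewrite mulmx_diag (_ : diag_mx _ = 1%:M) ?mul1mx // -diag_const_mx.
  by congr diag_mx; apply/rowP => j; rewrite !mxE mulVf ?lt0r_neq0.
have At (i : 'I_r) : exists N : 'M[C]_(r, i),
    forall z, z *m N = 0 -> toC (t i) * sqn z <= hform A z.
  rewrite /t; case: (leP (c * _)) => _.
    (* The constraint is put on [z *m P^T], which has the norm of [z] since [P^T *m P] is the
       identity; [TX] cancels Sigma and leaves the form of [W^-2] there. *)
    exists ((P^T)^C *m pid_mx i) => z; rewrite mulmxA => zP.
    rewrite hformA.
    apply: le_trans (_ : hform (diag_mx lam)^C (z *m T *m U^t* ) <= _).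
      rewrite -hform_adj_conj -gramE hform_gram -[z *m T *m _]mulmxA TX mulmxA.
      rewrite -[sqn z]hform1 -(map_mx1 toC) -P_orth hform_gram.
      exact: (@le_sqr_inv_diag _ w (widen_ord le_rn i)).
    by apply: hform_diag_ge => j _; rewrite mxE le_max lexx orbT.
  (* Here the constraint is on [z] itself: [L] is bounded below by [c], and what remains is the form
     of [Sigma^-2]. *)
  exists (pid_mx i) => z zi.
  rewrite hformA.
  apply: le_trans
    (_ : hform (diag_mx (const_mx c))^C (z *m T *m U^t* ) <= _).
    rewrite hform_const sqn_unitary ?trmxC_unitary // rmorphM -mulrA.
    by rewrite ler_wpM2l ?ler0c // le_sqr_inv_diag.
  by apply: hform_diag_ge => j _; rewrite !mxE le_max lexx.
have := prod_le_det A_adj t_ge0 At.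
rewrite /A T_adj 2!det_mulmx det_unitary_conj // !det_map_mx !det_diag.
rewrite -!rmorphM lecR -!big_split /= => le_prod_t.
(* Multiplying by the square of [det Sigma] clears the two factors [\det T]. *)
have s2_ge0 : 0 <= \prod_i s 0 i ^+ 2.
  by apply: prodr_ge0 => i _; rewrite exprn_ge0 // ltW.
move: (ler_wpM2r s2_ge0 le_prod_t); rewrite -!big_split /=.
rewrite [X in X <= _ -> _](eq_bigr (fun i =>
    Num.max c ((s 0 i / w 0 (widen_ord le_rn i)) ^+ 2))) => [|i _].
  congr (_ <= _); apply: eq_bigr => i _; rewrite !mxE.
  by field; rewrite lt0r_neq0.
rewrite /t maxr_pMl ?exprn_ge0 // ?ltW //; congr Num.max.
  by field; rewrite lt0r_neq0.
by rewrite exprMn mulrC.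
Qed.

End HermitianForms.

(** * Eigenvalue lists and characteristic polynomials *)

Lemma char_poly_conj (F : comNzRingType) n (B A U : 'M[F]_n) :
  B *m U = 1%:M -> char_poly (B *m A *m U) = char_poly A.
Proof.
move=> BU; have BU' : map_mx polyC B *m map_mx polyC U = 1%:M.
  by rewrite -map_mxM BU map_mx1.
rewrite /char_poly /char_poly_mx !map_mxM.
have {1}-> : 'X%:M = map_mx polyC B *m 'X%:M *m map_mx polyC U.
  by rewrite scalar_mxC -mulmxA BU' mulmx1.
by rewrite -mulmxBl -mulmxBr 2!det_mulmx mulrAC -det_mulmx BU' det1 mul1r.
Qed.

(** Over [R[i]] the characteristic polynomial of [M] splits with roots [d]. The factorization
    descends to [R], where the roots with multiplicity, once sorted, form the already sorted list
    [d]. *)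
Lemma eigenvalues_spectral (R : realType) n (M : 'M[R]_n) (U : 'M[R[i]]_n)
    (d : 'rV[R]_n) :
  U \is unitarymx ->
  map_mx (real_complex R) M = U^t* *m map_mx (real_complex R) (diag_mx d) *m U ->
  (forall i j : 'I_n, (i <= j)%N -> d 0 j <= d 0 i) ->
  forall i : 'I_n, (eigenvalues M)`_i = d 0 i.
Proof.
move=> U_unit ME d_mono i; pose s := [seq d 0 i | i <- enum 'I_n].
have charE : char_poly M = \prod_(x <- s) ('X - x%:P).
  apply: (@map_poly_inj _ _ (real_complex R)).
  rewrite map_char_poly ME char_poly_conj ?mul_adj_unitary // -map_char_poly.
  rewrite char_poly_trig ?diag_mx_is_trig // big_map big_enum; congr map_poly.
  by apply: eq_bigr => j _; rewrite mxE eqxx mulr1n.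
have char_neq0 : char_poly M != 0 by rewrite monic_neq0 ?char_poly_monic.
have roots_s : perm_eq (rootsR (char_poly M)) (undup s).
  apply: uniq_perm; rewrite ?undup_uniq ?uniq_roots // => x.
  rewrite mem_undup -(roots_on_rootsR char_neq0) in_itv /= charE.
  exact: root_prod_XsubC.
have nth_s (j : 'I_n) : s`_j = d 0 j.
  by rewrite /s (nth_map j) ?size_enum_ord // nth_ord_enum.
have s_sorted : sorted >=%R s.
  apply/(sortedP 0) => j; rewrite size_map size_enum_ord => ltj.
  have := d_mono (Ordinal (ltnW ltj)) (Ordinal ltj) (leqnSn j).
  by rewrite -!nth_s.
have -> : eigenvalues M = s.
  rewrite -[RHS](sorted_sort ge_trans s_sorted).
  apply/perm_sortP; [exact: ge_total|exact: ge_trans|exact: ge_anti|].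
  rewrite (perm_trans _ (perm_count_undup s)) // charE.
  under eq_map do rewrite mu_prod_XsubC.
  by rewrite -charE; apply/perm_flatten/perm_map.
exact: nth_s.
Qed.

(** * Weak majorization *)

(** Subtracting the last weight from all weights removes the last term and splits off that weight
    times the full sum of [a]; induction handles the rest. *)
Lemma sum_mul_nonincreasing_ge0 (R : realDomainType) n (a w : 'I_n -> R) :
  (forall i, 0 <= w i) -> (forall i j : 'I_n, (i <= j)%N -> w j <= w i) ->
  (forall k, (k <= n)%N -> 0 <= \sum_(i < n | (i < k)%N) a i) ->
  0 <= \sum_i w i * a i.
Proof.
elim: n a w => [|n IHn] a w w_ge0 w_mono a_ge0; first by rewrite big_ord0.
have -> : \sum_i w i * a i =
    \sum_i (w i - w ord_max) * a i + w ord_max * \sum_i a i.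
  by rewrite mulr_sumr -big_split; apply: eq_bigr => i _ /=; ring.
rewrite addr_ge0 ?mulr_ge0 //; last first.
  by have := a_ge0 n.+1 (leqnn _); under eq_bigl do rewrite ltn_ord.
rewrite big_ord_recr /= subrr mul0r addr0; apply: IHn => [i|i j le_ij|k le_kn].
- by rewrite subr_ge0 w_mono // leq_ord.
- by rewrite lerD2r w_mono.
have := a_ge0 k (leqW le_kn); rewrite big_mkcond big_ord_recr -big_mkcond /=.
by rewrite ltnNge le_kn addr0; exact.
Qed.

(* With c the k-th largest lam, the product inequality says that the product of
   the k largest del is at most that of the k largest lam. The conclusion then
   follows by summation by parts, dphi being the derivative of phi with respect
   to ln. *)
Lemma sum_le_of_prod_max (R : realType) r (lam del : 'I_r -> R)
    (phi dphi : R -> R) :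
  (forall i, 0 < del i) -> (forall i j : 'I_r, (i <= j)%N -> lam j <= lam i) ->
  (forall c, 0 <= c ->
    \prod_i Num.max c (del i) <= \prod_i Num.max c (lam i)) ->
  (forall b, 0 < b -> 0 <= dphi b) ->
  (forall a b, 0 < a -> a <= b -> dphi a <= dphi b) ->
  (forall a b, 0 < a -> 0 < b -> dphi b * (ln a - ln b) <= phi a - phi b) ->
  \sum_i phi (del i) <= \sum_i phi (lam i).
Proof.
move=> del_gt0 lam_mono prod_le dphi_ge0 dphi_mono phi_ge.
(* The largest entries on each side are compared; [lam] is already nonincreasing, so [del] is
   rearranged to match. *)
have [s del_mono] := exists_sorting_perm del (@ge_total _ R) (@ge_trans _ R).
pose y i := del (s i).
have {}prod_le c : 0 <= c ->
    \prod_i Num.max c (y i) <= \prod_i Num.max c (lam i).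
  by move=> /prod_le; rewrite (reindex_perm s).
(* At [c = 0] the left product is positive, whereas a nonpositive [lam i] would make the right one
   vanish. *)
have lam_gt0 i : 0 < lam i.
  have : 0 < \prod_i Num.max 0 (y i).
    by apply: prodr_gt0 => j _; rewrite lt_max del_gt0 orbT.
  move=> /lt_le_trans/(_ (prod_le 0 (lexx 0))); apply: contraTT.
  by rewrite -!leNgt (bigD1 i) //= => /max_idPl ->; rewrite mul0r.
rewrite (reindex_perm s) -subr_ge0 -sumrB.
apply: (@le_trans _ _ (\sum_i dphi (y i) * (ln (lam i) - ln (y i)))); last first.
  by apply: ler_sum => i _; rewrite phi_ge // del_gt0.
apply: sum_mul_nonincreasing_ge0 => [i|i j le_ij|[|k] lt_kr].
- exact/dphi_ge0/del_gt0.
- by apply: dphi_mono; [exact: del_gt0|exact: del_mono].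
- by rewrite big_pred0.
pose c := lam (Ordinal lt_kr).
have expE (f : 'I_r -> R) : (forall i, 0 < f i) ->
    \prod_(i < r) (if (i < k.+1)%N then f i else c) =
    expR (\sum_(i < r) (if (i < k.+1)%N then ln (f i) else ln c)).
  move=> f_gt0; rewrite expR_sum; apply: eq_bigr => i _.
  by case: ifP => _; rewrite lnK ?posrE ?f_gt0 ?lam_gt0.
rewrite big_mkcond /=.
(* On the left, [max(c, y i)] dominates both [y i] and [c]; on the right, [max(c, lam i)] is [lam i]
   up to index [k] and [c] beyond. The common factors [c] cancel after taking logarithms. *)
have : \prod_(i < r) (if (i < k.+1)%N then y i else c) <=
       \prod_(i < r) (if (i < k.+1)%N then lam i else c).
  apply: le_trans (le_trans (prod_le c (ltW (lam_gt0 _))) _).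
    apply: ler_prod => i _; case: ifP => _.
      by rewrite ltW ?del_gt0 //= le_max lexx orbT.
    by rewrite ltW ?lam_gt0 //= le_max lexx.
  apply: ler_prod => i _; rewrite le_max (ltW (lam_gt0 _)) /=.
  case: ltnP => [lt_ik|le_ki]; first by rewrite ge_max lexx andbT lam_mono.
  by rewrite ge_max lexx lam_mono // ltnW.
rewrite !expE // ?ler_expR => [|i]; last exact: del_gt0.
rewrite -subr_ge0 -sumrB => /le_trans; apply; apply: ler_sum => i _.
by case: ifP => // _; rewrite subrr.
Qed.

(** * Tangent-line inequalities in the variable ln *)

(** Convexity of [exp(p x)] at [x = ln b], from [1 + x <= exp x]. *)
Lemma powR_tangent (R : realType) (p a b : R) : 0 < a -> 0 < b ->
  p * b `^ p * (ln a - ln b) <= a `^ p - b `^ p.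
Proof.
move=> a_gt0 b_gt0; rewrite /powR !gt_eqF //.
set u := p * ln a; set v := p * ln b.
have -> : p * expR v * (ln a - ln b) = expR v * (1 + (u - v)) - expR v.
  by rewrite /u /v; ring.
by rewrite lerD2r -[in leRHS](subrKC v u) expRD ler_pM2l ?expR_gt0 ?expR_ge1Dx.
Qed.

Lemma ln_powRD_tangent (R : realType) (p eps a b : R) :
  0 < eps -> 0 < a -> 0 < b ->
  p * (b `^ p / (b `^ p + eps)) * (ln a - ln b) <=
  ln (a `^ p + eps) - ln (b `^ p + eps).
Proof.
move=> eps_gt0 a_gt0 b_gt0; rewrite /powR !gt_eqF //.
set u := p * ln a; set v := p * ln b; set B := expR v.
have B_gt0 : 0 < B by exact: expR_gt0.
have Beps_gt0 : 0 < B + eps by rewrite addr_gt0.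
(* [t] is the mean of [u - v] and 0 with weights [B] and [eps], so the linear terms cancel in the
   weighted sum of [1 + x <= exp x] at [x = u - v - t] and [x = - t]. *)
pose t := B / (B + eps) * (u - v).
have -> : p * (B / (B + eps)) * (ln a - ln b) = t by rewrite /t /u /v; ring.
rewrite lerBrDr -ler_expR expRD !lnK ?posrE ?addr_gt0 ?expR_gt0 //.
have le_eps : eps * (1 - t) <= eps * expR (- t).
  by rewrite ler_pM2l // expR_ge1Dx.
have le_B : B * (1 + (u - v - t)) <= expR u * expR (- t).
  have -> : expR u * expR (- t) = B * expR (u - v - t).
    by rewrite -!expRD; congr expR; ring.
  by rewrite ler_pM2l // expR_ge1Dx.
have sumE : B * (1 + (u - v - t)) + eps * (1 - t) = B + eps.
  by rewrite /t; field; rewrite gt_eqF.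
have := lerD le_B le_eps; rewrite sumE -mulrDl expRN ler_pdivlMr ?expR_gt0 //.
by rewrite mulrC.
Qed.

(** * Singular values and the two inequalities *)

(** One decomposition serves both the minimax argument, through [U] and [lam], and the definition of
    singular values, through [eigenvalues]. *)
Lemma gram_spectral (R : realType) m n (X : 'M[R]_(m, n)) :
  exists (U : 'M[R[i]]_n) (lam : 'rV[R]_n), [/\ U \is unitarymx,
    map_mx (real_complex R) (X^T *m X) =
      U^t* *m map_mx (real_complex R) (diag_mx lam) *m U,
    forall i j : 'I_n, (i <= j)%N -> lam 0 j <= lam 0 i &
    forall i : 'I_n, (eigenvalues (X^T *m X))`_i = lam 0 i].
Proof.
have gram_adj : (map_mx (real_complex R) (X^T *m X))^t* =
    map_mx (real_complex R) (X^T *m X).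
  by rewrite adj_toC trmx_mul trmxK.
have [U [lam [U_unit ME lam_mono]]] :=
  hermitian_spectral (@ge_total _ R) (@ge_trans _ R) gram_adj.
by exists U, lam; split=> //; exact: eigenvalues_spectral ME _.
Qed.

(** Common core of both claims, stated for squares so that [phi] absorbs the square root in
    [singular_value]. *)
Lemma sum_phi_le_eigenvalues (R : realType) (n r : nat)
    (le_rn : (r <= n)%N) (W : 'M[R]_n) (Sigma : 'M[R]_r) (P X : 'M[R]_(n, r))
    (phi dphi : R -> R) :
  is_diag_mx W -> is_diag_mx Sigma ->
  (forall i j : 'I_n, (i <= j)%N -> W j j <= W i i) ->
  (forall i : 'I_n, 0 < W i i) ->
  (forall i j : 'I_r, (i <= j)%N -> Sigma j j <= Sigma i i) ->
  (forall i : 'I_r, 0 < Sigma i i) ->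
  P^T *m P = 1%:M ->
  (forall b, 0 < b -> 0 <= dphi b) ->
  (forall a b, 0 < a -> a <= b -> dphi a <= dphi b) ->
  (forall a b, 0 < a -> 0 < b -> dphi b * (ln a - ln b) <= phi a - phi b) ->
  X = invmx W *m P *m Sigma ->
  \sum_i phi ((Sigma i i / W (widen_ord le_rn i) (widen_ord le_rn i)) ^+ 2) <=
  \sum_(i < r) phi (eigenvalues (X^T *m X))`_i.
Proof.
move=> /diag_mxP[w ->] /diag_mxP[s ->].
have diagE k (v : 'rV[R]_k) i : diag_mx v i i = v 0 i by rewrite mxE eqxx.
move=> W_mono W_gt0 S_mono S_gt0 P_orth dphi_ge0 dphi_mono phi_ge XE.
have w_gt0 i : 0 < w 0 i by rewrite -diagE.
have s_gt0 i : 0 < s 0 i by rewrite -diagE.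
have invW : invmx (diag_mx w) = diag_mx (\row_i (w 0 i)^-1).
  have wV : diag_mx w *m diag_mx (\row_i (w 0 i)^-1) = 1%:M.
    rewrite mulmx_diag -diag_const_mx; congr diag_mx.
    by apply/rowP => j; rewrite !mxE mulfV ?lt0r_neq0.
  have [w_unit _] := mulmx1_unit wV.
  by rewrite -[RHS](mulKmx w_unit) wV mulmx1.
have [U [lam [U_unit gramE lam_mono lamE]]] := gram_spectral X.
under [leRHS]eq_bigr do rewrite lamE.
apply: (sum_le_of_prod_max (dphi := dphi)) => // [i|c c_ge0].
  by rewrite !diagE exprn_gt0 // divr_gt0.
under eq_bigr do rewrite !diagE.
apply: (prod_max_le_eigenvalues _ _ _ _ _ P_orth _ U_unit gramE c_ge0) => //.
- by move=> i j /W_mono; rewrite !diagE.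
- by move=> i j /S_mono; rewrite !diagE.
- by rewrite XE invW.
Qed.

Lemma sqrt_powR (R : realType) (a p : R) :
  0 <= a -> Num.sqrt a `^ p = a `^ (p / 2).
Proof. by move=> a_ge0; rewrite -powR12_sqrt // -powRrM mulrC. Qed.

Theorem theorem3p1 (R : realType) (n r : nat) (r_gt0 : (0 < r)%N)
    (le_rn : (r <= n)%N) (eps : R) (eps_gt0 : 0 < eps)
    (W : 'M[R]_n) (Sigma : 'M[R]_r)
    (W_diag : is_diag_mx W) (Sigma_diag : is_diag_mx Sigma)
    (W_noninc : forall i j : 'I_n, (i <= j)%N -> W j j <= W i i)
    (W_gt0 : forall i : 'I_n, 0 < W i i)
    (Sigma_noninc : forall i j : 'I_r, (i <= j)%N -> Sigma j j <= Sigma i i)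
    (Sigma_gt0 : forall i : 'I_r, 0 < Sigma i i)
    (P : 'M[R]_(n, r)) (P_orth : P^T *m P = 1%:M)
    (q : R) (q_neq0 : q != 0) (q_nat : exists j : nat, (2 - q) / q = j%:R) :
  schatten_norm q (invmx W *m P *m Sigma) `^ q >=
    \sum_(i < r)
      (Sigma i i / W (widen_ord le_rn i) (widen_ord le_rn i)) `^ q
  /\ (forall k : nat, k = 1%N \/ k = 2%N ->
      log_norm eps k%:R^-1 (invmx W *m P *m Sigma) >=
        \sum_(i < r)
          ln ((Sigma i i / W (widen_ord le_rn i) (widen_ord le_rn i))
                `^ k%:R^-1 + eps)).
Proof.
set X := invmx W *m P *m Sigma.
have dE (i : 'I_r) : Sigma i i / W (widen_ord le_rn i) (widen_ord le_rn i) =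
    Num.sqrt ((Sigma i i / W (widen_ord le_rn i) (widen_ord le_rn i)) ^+ 2).
  by rewrite sqrtr_sqr ger0_norm // divr_ge0 // ltW.
split.
  (* A negative [q] would force [2 - q <= 0], hence [2 <= q < 0]. *)
  have q_gt0 : 0 < q.
    case: q_nat => j qj; rewrite lt0r q_neq0 /= leNgt; apply/negP => q_lt0.
    have : 0 <= (2 - q) / q by rewrite qj.
    rewrite nmulr_lge0 ?invr_lt0 // subr_le0 => /le_lt_trans/(_ q_lt0).
    by rewrite ltrn0.
  have q2_ge0 : 0 <= q / 2 by rewrite divr_ge0 ?ltW.
  rewrite /schatten_norm -powRrM mulVf // powRr1; last first.
    by apply: sumr_ge0 => i _; exact: powR_ge0.
  rewrite /singular_value (minn_idPr le_rn).
  under [leLHS]eq_bigr do rewrite dE.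
  (* For positive [a], [phi] is the power [q / 2] of [a]; the second function is its derivative with
     respect to [ln a]. *)
  apply: (@sum_phi_le_eigenvalues _ _ _ _ _ _ P _ (fun a => Num.sqrt a `^ q)
    (fun b => q / 2 * b `^ (q / 2))) => //
    [b b_gt0|a b a_gt0 le_ab|a b a_gt0 b_gt0].
  - by rewrite mulr_ge0 ?powR_ge0.
  - rewrite ler_wpM2l // ge0_ler_powR ?nnegrE // ltW //.
    exact: lt_le_trans le_ab.
  - by rewrite !sqrt_powR ?(ltW a_gt0) ?(ltW b_gt0) // powR_tangent.
move=> k k12.
have k_gt0 : 0 < k%:R^-1 :> R by case: k12 => ->; rewrite invr_gt0 ltr0n.
move: k%:R^-1 k_gt0 => p p_gt0.
have p2_ge0 : 0 <= p / 2 by rewrite divr_ge0 ?ltW.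
rewrite /log_norm /singular_value (minn_idPr le_rn).
under [leLHS]eq_bigr do rewrite dE.
apply: (@sum_phi_le_eigenvalues _ _ _ _ _ _ P _
  (fun a => ln (Num.sqrt a `^ p + eps))
  (fun b => p / 2 * (b `^ (p / 2) / (b `^ (p / 2) + eps)))) => //
  [b b_gt0|a b a_gt0 le_ab|a b a_gt0 b_gt0].
- by rewrite mulr_ge0 // divr_ge0 ?addr_ge0 ?powR_ge0 // ltW.
(* Monotonicity of [x / (x + eps)], by cross-multiplication. *)
- rewrite ler_wpM2l // ler_pdivrMr ?ltr_wpDl ?powR_ge0 //.
  rewrite mulrAC ler_pdivlMr ?ltr_wpDl ?powR_ge0 //.
  rewrite !mulrDr [in leRHS]mulrC lerD2l ler_pM2r //.
  by rewrite ge0_ler_powR ?nnegrE // ltW // (lt_le_trans a_gt0).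
- by rewrite !sqrt_powR ?(ltW a_gt0) ?(ltW b_gt0) // ln_powRD_tangent.
Qed.
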